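(* Let $0<|q|<1$, $0<|p|<1$, let $r\in\mathbb{N}$ be a positive integer, and let $x,y$ be nonzero complex numbers. (I) Let $a,b,c,d\in\mathbb{C}$ with $p^{c}\neq p^{-n}$ and $q^{d}\ne q^{-n}$ for all integers $n\ge 0$. If $|x|,|y|<1$, then $$\mathbb{D}_{y,p}^{r}\Big[y^{b+r-1}\Psi_{1}(q^{a},p^{b};p^{c},q^{d};q,p,x,y)\Big]=\frac{(p^{b};p)_{r}}{(1-p)^{r}}y^{b-1}\Psi_{1}(q^{a},p^{b+r};p^{c},q^{d};q,p,x,y).$$ If $|x|,|xy|<1$, then $$\mathbb{D}_{x,q}^{r}\Big[x^{a+r-1}\Psi_{1}(q^{a},p^{b};p^{c},q^{d};q,p,x,xy)\Big]=\frac{(q^{a};q)_{r}}{(1-q)^{r}}x^{a-1}\Psi_{1}(q^{a+r},p^{b};p^{c},q^{d};q,p,x,xy).$$ If $|xy|,|y|<1$, then $$\mathbb{D}_{y,q}^{r}\Big[y^{a+r-1}\Psi_{1}(q^{a},p^{b};p^{c},q^{d};q,p,xy,y)\Big]=\frac{(q^{a};q)_{r}}{(1-q)^{r}}y^{a-1}\Psi_{1}(q^{a+r},p^{b};p^{c},q^{d};q,p,xy,y).$$ (II) Let $a,b,c\in\mathbb{C}$ with $p^{b}\neq p^{-n}$ and $q^{c}\ne q^{-n}$ for all integers $n\ge 0$. If $|x|,|xy|<1$, then $$\mathbb{D}_{x,q}^{r}\Big[x^{a+r-1}\Psi_{2}(q^{a};p^{b},q^{c};q,p,x,xy)\Big]=\frac{(q^{a};q)_{r}}{(1-q)^{r}}x^{a-1}\Psi_{2}(q^{a+r};p^{b},q^{c};q,p,x,xy).$$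 If $|xy|,|y|<1$, then $$\mathbb{D}_{y,q}^{r}\Big[y^{a+r-1}\Psi_{2}(q^{a};p^{b},q^{c};q,p,xy,y)\Big]=\frac{(q^{a};q)_{r}}{(1-q)^{r}}y^{a-1}\Psi_{2}(q^{a+r};p^{b},q^{c};q,p,xy,y).$$
   Context: $q,p\in\mathbb{C}$ are two independent bases with $0<|q|<1$, $0<|p|<1$; logarithms of $q$ and $p$ are fixed so that $q^{a}=e^{a\log q}$, $p^{b}=e^{b\log p}$ for complex exponents. The complex powers of the variables are chosen compatibly along the orbits $x,qx,q^2x,\dots$ (resp. $y,py,p^2y,\dots$ or $y,qy,q^2y,\dots$), i.e. $(qx)^{s}=q^{s}x^{s}$, $(py)^{s}=p^{s}y^{s}$, $(qy)^{s}=q^{s}y^{s}$ and $x^{s+1}=x\cdot x^{s}$, $y^{s+1}=y\cdot y^{s}$. The $q$-shifted factorial is $(A;q)_{0}=1$, $(A;q)_{k}=\prod_{j=0}^{k-1}(1-Aq^{j})$ for $k\ge1$ (similarly with base $p$). The $q$-difference operator in a variable $x$ is $\mathbb{D}_{x,q}f(x)=\dfrac{f(x)-f(qx)}{(1-q)x}$, $x\ne0$ (other variables fixed, acting on the whole bracket as a function of $x$); $\mathbb{D}_{y,q}$, $\mathbb{D}_{y,p}$ are the analogues in $y$ with bases $q$, $p$; powers denote iteration. The bibasic Humbert functions are, for $|x|,|y|<1$ and whenever no denominator factor vanishes, $$\Psi_{1}(q^{a},p^{b};p^{c},q^{d};q,p,x,y)=\sum_{\ell,k=0}^{\infty}\frac{(q^{a};q)_{k+\ell}(p^{b};p)_{\ell}}{(p^{c};p)_{\ell}(q^{d};q)_{k}(q;q)_{k}(p;p)_{\ell}}x^{k}y^{\ell},$$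 $$\Psi_{2}(q^{a};p^{b},q^{c};q,p,x,y)=\sum_{\ell,k=0}^{\infty}\frac{(q^{a};q)_{k+\ell}}{(p^{b};p)_{\ell}(q^{c};q)_{k}(q;q)_{k}(p;p)_{\ell}}x^{k}y^{\ell}.$$ *)

(* Defs.v *)
From Stdlib Require Import Reals.
From Coquelicot Require Import Coquelicot.
Open Scope C_scope.

Definition Cexp (z : C) : C :=
  (exp (Re z) * cos (Im z), exp (Re z) * sin (Im z))%R.

(** [qpow lq s] is q^s, where [lq] is the fixed logarithm of the base q. *)
Definition qpow (lq s : C) : C := Cexp (s * lq).

(** [pw z s] plays the role of z^s for z in the orbit x, qx, q^2 x, ...:
    it is one of the values of the multivalued power z^s, and the choices made
    along the orbit are compatible.  Nothing is asked of [pw] off the orbit. *)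
Definition compatible_power (q lq x : C) (pw : C -> C -> C) : Prop :=
  forall (n : nat) (s : C),
    let z := q ^ n * x in
    (exists l : C, Cexp l = z /\ pw z s = Cexp (s * l)) /\
    pw (q * z) s = qpow lq s * pw z s /\
    pw z (s + 1) = z * pw z s.

(** The q-shifted factorial (A;q)_k. *)
Fixpoint qpoch (A q : C) (k : nat) : C :=
  match k with
  | O => 1
  | S j => qpoch A q j * (1 - A * q ^ j)
  end.

Definition qdiff (q : C) (f : C -> C) (x : C) : C :=
  (f x - f (q * x)) / ((1 - q) * x).

(** Convergence of the rectangular partial sums as both bounds tend to
    infinity independently, so no order of summation is preferred. *)
Definition is_double_series (u : nat -> nat -> C) (s : C) : Prop :=
  filterlim
    (fun N : nat * nat =>
       sum_n (fun l => sum_n (fun k => u l k) (snd N)) (fst N))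
    (filter_prod eventually eventually) (locally s).

(** Meaningful when the double series converges; [iota] returns an unspecified
    value otherwise. *)
Definition double_series (u : nat -> nat -> C) : C :=
  iota (T := C_CompleteNormedModule) (is_double_series u).

(** [Psi1 A B G D q p x y] is Psi_1(A, B; G, D; q, p, x, y), to be used with
    A = q^a, B = p^b, G = p^c, D = q^d. *)
Definition Psi1 (A B G D q p x y : C) : C :=
  double_series (fun l k : nat =>
    (qpoch A q (k + l) * qpoch B p l)
    / (qpoch G p l * qpoch D q k * qpoch q q k * qpoch p p l)
    * x ^ k * y ^ l).

(** [Psi2 A B G q p x y] is Psi_2(A; B, G; q, p, x, y), to be used with
    A = q^a, B = p^b, G = q^c. *)
Definition Psi2 (A B G q p x y : C) : C :=
  double_series (fun l k : nat =>
    qpoch A q (k + l)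
    / (qpoch B p l * qpoch G q k * qpoch q q k * qpoch p p l)
    * x ^ k * y ^ l).

(* Main.v *)
(** On the orbit z, qz, q^2 z, ..., the argument of the operator is a double
    series of terms w t^(a+r-1+deg), where deg is the exponent of the variable t in the
    monomial. Termwise, D_q^r multiplies such a term by
    (q^(a+deg);q)_r / (1-q)^r and lowers the exponent by r; then
    (q^a;q)_deg (q^(a+deg);q)_r = (q^a;q)_(deg+r) = (q^a;q)_r (q^(a+r);q)_deg.
    Working termwise is legitimate because the q-shifted factorials and their inverses are
    bounded, so that the double series are dominated by products of geometric series. *)

Require Import Defs.
From Stdlib Require Import Reals.
From Coquelicot Require Import Coquelicot.
From Stdlib Require Import Lra Lia FunctionalExtensionality.
Open Scope C_scope.

(* Coquelicot's generic operations on the structures over C hide the ring C from [ring]. *)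
Ltac C_ring := unfold minus; match goal with |- @eq _ ?a ?b =>
  change (@eq C a b);
  repeat change (@plus _ ?a ?b) with (Cplus a b);
  repeat change (@opp _ ?a) with (Copp a); ring end.

(** * Double series: uniqueness of the sum and linearity *)

Definition ex_double_series (u : nat -> nat -> C) : Prop :=
  exists s, is_double_series u s.

Lemma double_series_unique (u : nat -> nat -> C) (s : C) :
  is_double_series u s -> double_series u = s.
Proof.
  exact (iota_filterlim_locally (V := C_CompleteNormedModule) _ s).
Qed.

Lemma double_series_correct (u : nat -> nat -> C) :
  ex_double_series u -> is_double_series u (double_series u).
Proof.
  intros [s Hs]; rewrite (double_series_unique u s Hs); exact Hs.
Qed.

Lemma double_sum_scal (c : C) (u : nat -> nat -> C) (L K : nat) :
  sum_n (fun l => sum_n (fun k => c * u l k) K) L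
  = c * sum_n (fun l => sum_n (fun k => u l k) K) L.
Proof.
  change (c * sum_n (fun l => sum_n (fun k => u l k) K) L)
    with (mult c (sum_n (G := C_Ring) (fun l => sum_n (fun k => u l k) K) L)).
  rewrite <- (sum_n_mult_l (K := C_Ring)); apply sum_n_ext; intros l.
  exact (sum_n_mult_l (K := C_Ring) c (u l) K).
Qed.

Lemma is_double_series_scal (c : C) (u : nat -> nat -> C) (s : C) :
  is_double_series u s -> is_double_series (fun l k => c * u l k) (c * s).
Proof.
  intros Hu.
  apply filterlim_ext with
    (fun N => c * sum_n (fun l => sum_n (fun k => u l k) (snd N)) (fst N)).
  { intros N; symmetry; apply double_sum_scal. }
  eapply filterlim_comp; [exact Hu |].
  exact (filterlim_scal_r (V := C_NormedModule) c s).
Qed.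

Lemma sum_n_Cminus (f g : nat -> C) (n : nat) :
  sum_n (fun k => f k - g k) n = sum_n f n - sum_n g n.
Proof.
  induction n as [|n IH]; rewrite ?sum_O, ?sum_Sn; [reflexivity |].
  rewrite IH; C_ring.
Qed.

Lemma is_double_series_minus (u v : nat -> nat -> C) (s t : C) :
  is_double_series u s -> is_double_series v t ->
  is_double_series (fun l k => u l k - v l k) (s - t).
Proof.
  intros Hu Hv.
  apply filterlim_ext with
    (fun N => Cplus (sum_n (fun l => sum_n (fun k => u l k) (snd N)) (fst N))
      (Copp (sum_n (fun l => sum_n (fun k => v l k) (snd N)) (fst N)))).
  { intros N; symmetry; etransitivity; [| apply sum_n_Cminus].
    apply sum_n_ext; intros l; apply sum_n_Cminus. }
  eapply filterlim_comp_2.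
  - exact Hu.
  - eapply filterlim_comp; [exact Hv |].
    apply (filterlim_opp (V := C_NormedModule)).
  - apply (filterlim_plus (V := C_NormedModule)).
Qed.

(** * Convergence under a geometric majorant *)

(** The difference of partial sums is the block of terms with indices n+1 to m, to which the
    triangle inequality applies. It serves the Cauchy estimate below in both directions of
    summation. *)
Lemma Cmod_sum_n_minus_le (a : nat -> C) (b : nat -> R) (n m : nat) :
  (n <= m)%nat -> (forall k, Cmod (a k) <= b k)%R ->
  (Cmod (sum_n a m - sum_n a n) <= sum_n b m - sum_n b n)%R.
Proof.
  intros Hnm Hab.
  apply Rle_trans with (sum_n_m b (S n) m);
    [| right; exact (sum_n_m_sum_n (G := R_AbelianGroup) b n m Hnm)].
  replace (sum_n a m - sum_n a n) with (sum_n_m a (S n) m)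
    by exact (sum_n_m_sum_n (G := C_AbelianGroup) a n m Hnm).
  eapply Rle_trans; [apply (norm_sum_n_m (V := C_NormedModule)) |].
  apply sum_n_m_le; exact Hab.
Qed.

Lemma Cmod_sum_n_le (a : nat -> C) (b : nat -> R) (n : nat) :
  (forall k, Cmod (a k) <= b k)%R -> (Cmod (sum_n a n) <= sum_n b n)%R.
Proof.
  intros Hab; eapply Rle_trans; [apply (norm_sum_n_m (V := C_NormedModule)) |].
  apply sum_n_m_le; exact Hab.
Qed.

(** [s] goes with the outer index [l], [r] with the inner index [k]. The majorant factors into two
    single geometric series, and multiplying [u] by a bounded factor only changes [M]. *)
Definition geom_dominated (u : nat -> nat -> C) : Prop :=
  exists M r s : R, (0 <= r < 1)%R /\ (0 <= s < 1)%R /\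
    forall l k, (Cmod (u l k) <= M * s ^ l * r ^ k)%R.

Lemma geom_partial_sums_cvg (s : R) : (0 <= s < 1)%R ->
  filterlim (sum_n (fun n => s ^ n)%R) eventually (locally (/ (1 - s))%R).
Proof.
  intros Hs; apply (is_series_geom s); rewrite Rabs_pos_eq; lra.
Qed.

(** Cauchy criterion along the product filter: when the rectangle grows, the sums of [u] move no
    more than those of the majorant, which converge. *)
Lemma geom_dominated_ex_double_series (u : nat -> nat -> C) :
  geom_dominated u -> ex_double_series u.
Proof.
  intros (M & r & s & Hr & Hs & Hu).
  set (S := fun N : nat * nat =>
       sum_n (fun l => sum_n (fun k => u l k) (snd N)) (fst N)).
  set (b := fun l k => (M * s ^ l * r ^ k)%R).
  set (T := fun N : nat * nat =>
       sum_n (fun l => sum_n (fun k => b l k) (snd N)) (fst N)).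
  (* A rectangular sum of the majorant is [M] times a product of two geometric partial sums, one for
     each index. *)
  assert (HT : filterlim T (filter_prod eventually eventually)
            (locally (M * (/ (1 - s) * / (1 - r)))%R)).
  { apply filterlim_ext with (fun N : nat * nat => scal M (mult
      (sum_n (fun n => s ^ n)%R (fst N)) (sum_n (fun n => r ^ n)%R (snd N)))).
    { intros N; unfold T, b.
      change (M * (sum_n (fun n => s ^ n) (fst N) * sum_n (fun n => r ^ n) (snd N))
        = sum_n (fun l => sum_n (fun k => M * s ^ l * r ^ k) (snd N)) (fst N))%R.
      rewrite <- Rmult_assoc.
      rewrite <- (sum_n_mult_l (K := R_Ring) M (fun n => s ^ n)%R).
      rewrite <- (sum_n_mult_r (K := R_Ring) _ (fun n => mult M (s ^ n)%R)).
      apply sum_n_ext; intros l.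
      rewrite <- (sum_n_mult_l (K := R_Ring)); apply sum_n_ext; reflexivity. }
    eapply filterlim_comp;
      [| apply (filterlim_scal_r (V := R_NormedModule))].
    eapply filterlim_comp_2; [| | apply (filterlim_mult (K := R_AbsRing))].
    - eapply filterlim_comp; [apply filterlim_fst | apply geom_partial_sums_cvg, Hs].
    - eapply filterlim_comp; [apply filterlim_snd | apply geom_partial_sums_cvg, Hr]. }
  (* The rectangle is enlarged in two moves, through the intermediate corner (L', K). *)
  assert (HST : forall L K L' K', (L <= L')%nat -> (K <= K')%nat ->
     (Cmod (S (L', K') - S (L, K)) <= T (L', K') - T (L, K))%R).
  { intros L K L' K' HL HK.
    apply Rle_trans with ((T (L', K') - T (L', K)) + (T (L', K) - T (L, K)))%R;
      [| right; ring].
    replace (S (L', K') - S (L, K))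
      with ((S (L', K') - S (L', K)) + (S (L', K) - S (L, K))) by C_ring.
    eapply Rle_trans; [apply Cmod_triangle |].
    apply Rplus_le_compat.
    (* Widening from K to K' columns: induction on the number of rows, each row contributing its own
       block. *)
    - unfold S, T; cbn [fst snd]; clear HL; induction L' as [|L' IH];
        rewrite ?sum_O, ?sum_Sn.
      { apply Cmod_sum_n_minus_le; [exact HK | apply Hu]. }
      match goal with |- (Cmod (plus ?A ?B - plus ?D ?E) <= _)%R =>
        replace (plus A B - plus D E) with ((A - D) + (B - E)) by C_ring
      end.
      eapply Rle_trans; [apply Cmod_triangle |].
      eapply Rle_trans; [apply Rplus_le_compat;
        [apply IH | apply Cmod_sum_n_minus_le; [exact HK | apply Hu]] |].
      right; repeat change (@plus _ ?a ?b) with (Rplus a b); unfold b; ring.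
    - apply Cmod_sum_n_minus_le; [exact HL |]; intros l.
      apply Cmod_sum_n_le, Hu. }
  apply (filterlim_locally_cauchy (U := C_CompleteNormedModule)
     (F := filter_prod eventually eventually)).
  intros eps.
  (* With [T] within eps/4 of its limit at (L, K) and at (N, N), both [T] and [S] move by less than
     eps/2 between them; two such comparisons through (N, N) give eps. *)
  assert (He : (0 < eps / 4)%R) by (generalize (cond_pos eps); lra).
  destruct (proj1 (filterlim_locally _ _) HT (mkposreal _ He))
    as [P Q [N1 HP] [N2 HQ] HPQ].
  set (N := Nat.max N1 N2).
  assert (HN : forall L K, (N <= L)%nat -> (N <= K)%nat ->
     (Cmod (S (L, K) - S (N, N)) < eps / 2)%R).
  { intros L K HL HK.
    eapply Rle_lt_trans; [apply HST; assumption |].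
    assert (H1 := HPQ L K (HP L ltac:(lia)) (HQ K ltac:(lia))).
    assert (H2 := HPQ N N (HP N ltac:(lia)) (HQ N ltac:(lia))).
    apply Rabs_lt_between' in H1; apply Rabs_lt_between' in H2.
    revert H1 H2; unfold pos; lra. }
  exists (fun v => (N <= fst v)%nat /\ (N <= snd v)%nat); split.
  - exists (fun L => (N <= L)%nat) (fun K => (N <= K)%nat);
      [exists N; auto | exists N; auto | auto].
  - intros [L K] [L' K'] [HL HK] [HL' HK'].
    apply (norm_compat1 (V := C_NormedModule)).
    change (Cmod (S (L', K') - S (L, K)) < eps)%R.
    replace (S (L', K') - S (L, K))
      with ((S (L', K') - S (N, N)) + - (S (L, K) - S (N, N))) by C_ring.
    eapply Rle_lt_trans; [apply Cmod_triangle |]; rewrite Cmod_opp.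
    cbn [fst snd] in *; generalize (HN L K HL HK) (HN L' K' HL' HK'); lra.
Qed.

Lemma geom_dominated_mult (u v : nat -> nat -> C) (B : R) :
  geom_dominated u -> (forall l k, Cmod (v l k) <= B)%R ->
  geom_dominated (fun l k => u l k * v l k).
Proof.
  intros (M & r & s & Hr & Hs & Hu) Hv.
  exists (M * B)%R, r, s; split; [exact Hr | split; [exact Hs |]]; intros l k.
  rewrite Cmod_mult.
  replace (M * B * s ^ l * r ^ k)%R with ((M * s ^ l * r ^ k) * B)%R by ring.
  apply Rmult_le_compat; auto using Cmod_ge_0.
Qed.

Lemma geom_dominated_powers (c : nat -> nat -> C) (B : R) (X Y : C) :
  (Cmod X < 1)%R -> (Cmod Y < 1)%R -> (forall l k, Cmod (c l k) <= B)%R ->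
  geom_dominated (fun l k => c l k * X ^ k * Y ^ l).
Proof.
  intros HX HY Hc.
  exists B, (Cmod X), (Cmod Y).
  split; [split; [apply Cmod_ge_0 | exact HX] |].
  split; [split; [apply Cmod_ge_0 | exact HY] |].
  intros l k; rewrite !Cmod_mult, !Cmod_pow.
  replace (B * Cmod Y ^ l * Cmod X ^ k)%R with (B * Cmod X ^ k * Cmod Y ^ l)%R by ring.
  repeat apply Rmult_le_compat_r; auto using pow_le, Cmod_ge_0.
Qed.

(** * Identities and bounds for q-shifted factorials *)

Lemma Cmod_pow_le_1 (q : C) (n : nat) : (Cmod q < 1)%R -> (Cmod (q ^ n) <= 1)%R.
Proof.
  intros Hq; rewrite Cmod_pow, <- (pow1 n).
  apply pow_incr; split; [apply Cmod_ge_0 | lra].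
Qed.

Lemma one_minus_neq_0 (z : C) : (Cmod z < 1)%R -> 1 - z <> 0.
Proof.
  intros Hz H; apply Ceq_minus in H; rewrite <- H, Cmod_1 in Hz; lra.
Qed.

(** [qpoch] recurses on its last factor; one more application of the difference operator produces a
    new first factor instead. *)
Lemma qpoch_S_l (A q : C) (n : nat) :
  qpoch A q (S n) = (1 - A) * qpoch (A * q) q n.
Proof.
  induction n as [|n IH]; [cbn; ring |].
  change (qpoch A q (S (S n))) with (qpoch A q (S n) * (1 - A * q ^ S n)).
  rewrite IH; cbn; ring.
Qed.

Lemma qpoch_add (A q : C) (m n : nat) :
  qpoch A q (m + n) = qpoch A q m * qpoch (A * q ^ m) q n.
Proof.
  induction n as [|n IH]; [rewrite Nat.add_0_r; cbn; ring |].
  rewrite Nat.add_succ_r; cbn; rewrite IH, Cpow_add_r; ring.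
Qed.

(** Each factor has modulus at most 1 + alpha. For fixed n the bound is uniform over |A| <= alpha,
    hence over parameters q^s q^deg with varying deg. *)
Lemma Cmod_qpoch_le (A q : C) (n : nat) (alpha : R) :
  (Cmod q < 1)%R -> (Cmod A <= alpha)%R -> (Cmod (qpoch A q n) <= (1 + alpha) ^ n)%R.
Proof.
  intros Hq HA; induction n as [|n IH]; cbn; [rewrite Cmod_1; lra |].
  rewrite Cmod_mult, (Rmult_comm (1 + alpha)).
  apply Rmult_le_compat; auto using Cmod_ge_0.
  eapply Rle_trans; [apply Cmod_triangle |].
  rewrite Cmod_1, Cmod_opp, Cmod_mult.
  generalize (Cmod_pow_le_1 q n Hq) (Cmod_ge_0 A); nra.
Qed.

(* Since 1 + t <= exp t, the product is at most |f 0| exp (K / (1 - rho)). *)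
Lemma prod_bounded (f e : nat -> C) (K rho : R) :
  (0 <= rho < 1)%R -> (0 <= K)%R ->
  (forall j, f (S j) = f j * (1 + e j)) -> (forall j, Cmod (e j) <= K * rho ^ j)%R ->
  exists B, forall n, (Cmod (f n) <= B)%R.
Proof.
  intros Hrho HK Hf He.
  assert (H : forall n, (Cmod (f n) <= Cmod (f O) * exp (K * (1 - rho ^ n) / (1 - rho)))%R).
  { induction n as [|n IH].
    - replace (K * (1 - rho ^ 0) / (1 - rho))%R with 0%R by (cbn; field; lra).
      rewrite exp_0; lra.
    - replace (K * (1 - rho ^ S n) / (1 - rho))%R
        with (K * (1 - rho ^ n) / (1 - rho) + K * rho ^ n)%R by (cbn; field; lra).
      rewrite exp_plus, Hf, Cmod_mult, <- Rmult_assoc.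
      apply Rmult_le_compat; auto using Cmod_ge_0.
      eapply Rle_trans; [apply Cmod_triangle |].
      eapply Rle_trans; [| apply exp_ineq1_le].
      rewrite Cmod_1; generalize (He n); lra. }
  exists (Cmod (f O) * exp (K / (1 - rho)))%R; intros n.
  eapply Rle_trans; [apply H |].
  apply Rmult_le_compat_l; [apply Cmod_ge_0 |].
  assert (Hle : (K * (1 - rho ^ n) / (1 - rho) <= K / (1 - rho))%R).
  { apply Rmult_le_compat_r; [left; apply Rinv_0_lt_compat; lra |].
    generalize (pow_le rho n (proj1 Hrho)); nra. }
  destruct Hle as [Hlt | ->]; [left; apply exp_increasing, Hlt | right; reflexivity].
Qed.

Lemma qpoch_bounded (A q : C) :
  (Cmod q < 1)%R -> exists B, forall n, (Cmod (qpoch A q n) <= B)%R.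
Proof.
  intros Hq.
  apply (prod_bounded _ (fun j => - (A * q ^ j)) (Cmod A) (Cmod q)).
  - split; [apply Cmod_ge_0 | exact Hq].
  - apply Cmod_ge_0.
  - reflexivity.
  - intros j; rewrite Cmod_opp, Cmod_mult, Cmod_pow; lra.
Qed.

(** Since 1/(1 - A q^j) = 1 + A q^j/(1 - A q^j), the inverse product has the shape required by
    [prod_bounded] once 1/|1 - A q^j| is bounded in j. *)
Lemma inv_qpoch_bounded (A q : C) :
  (Cmod q < 1)%R -> (forall n, 1 - A * q ^ n <> 0) ->
  exists B, forall n, (Cmod (/ qpoch A q n) <= B)%R.
Proof.
  intros Hq HA.
  (* Squeezing |1 - A q^n| between 1 - |A||q|^n and 1 + |A||q|^n gives the limit 1 for the inverses;
     a convergent sequence is bounded, which yields the constant [K] below. *)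
  assert (Hlim : is_lim_seq (fun n => / Cmod (1 - A * q ^ n))%R (/ 1)%R).
  { apply (is_lim_seq_inv _ 1); [| intros H; injection H; lra].
    apply is_lim_seq_le_le with (fun n => 1 - Cmod A * Cmod q ^ n)%R
                                (fun n => 1 + Cmod A * Cmod q ^ n)%R.
    - intros n; rewrite <- Cmod_pow, <- Cmod_mult; split.
      + generalize (Cmod_triangle (1 - A * q ^ n) (A * q ^ n)).
        replace (1 - A * q ^ n + A * q ^ n) with (RtoC 1) by ring.
        rewrite Cmod_1; lra.
      + eapply Rle_trans; [apply Cmod_triangle |].
        rewrite Cmod_1, Cmod_opp; lra.
    - replace (Finite 1) with (Finite (1 - Cmod A * 0)) by (f_equal; ring).
      apply is_lim_seq_minus'; [apply is_lim_seq_const |].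
      apply (is_lim_seq_scal_l _ _ 0), is_lim_seq_geom.
      rewrite Rabs_pos_eq by apply Cmod_ge_0; exact Hq.
    - replace (Finite 1) with (Finite (1 + Cmod A * 0)) by (f_equal; ring).
      apply is_lim_seq_plus'; [apply is_lim_seq_const |].
      apply (is_lim_seq_scal_l _ _ 0), is_lim_seq_geom.
      rewrite Rabs_pos_eq by apply Cmod_ge_0; exact Hq. }
  destruct (maj_by_pos _ (exist _ _ (proj1 (is_lim_seq_Reals _ _) Hlim)))
    as (K & HK & HKn).
  assert (Hnz : forall n, qpoch A q n <> 0).
  { induction n; cbn; [apply C1_nz | apply Cmult_neq_0; auto]. }
  apply (prod_bounded _ (fun j => A * q ^ j / (1 - A * q ^ j)) (Cmod A * K) (Cmod q)).
  - split; [apply Cmod_ge_0 | exact Hq].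
  - apply Rmult_le_pos; [apply Cmod_ge_0 | lra].
  - intros j; cbn; field; auto.
  - intros j; rewrite Cmod_div, Cmod_mult, Cmod_pow by apply HA.
    replace (Cmod A * K * Cmod q ^ j)%R with (Cmod A * Cmod q ^ j * K)%R by ring.
    apply Rmult_le_compat_l.
    + apply Rmult_le_pos; [| apply pow_le]; apply Cmod_ge_0.
    + eapply Rle_trans; [apply Rle_abs | apply HKn].
Qed.

(** * Complex powers of the bases *)

Lemma Cexp_plus (z w : C) : Cexp (z + w) = Cexp z * Cexp w.
Proof.
  destruct z as [z1 z2], w as [w1 w2]; unfold Cexp, Cmult, Cplus, Re, Im; cbn [fst snd].
  rewrite exp_plus, cos_plus, sin_plus; f_equal; ring.
Qed.

Lemma Cexp_0 : Cexp 0 = 1.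
Proof.
  unfold Cexp; cbn; rewrite exp_0, cos_0, sin_0; unfold RtoC; f_equal; ring.
Qed.

Lemma qpow_plus (lq s t : C) : qpow lq (s + t) = qpow lq s * qpow lq t.
Proof.
  unfold qpow; rewrite <- Cexp_plus; f_equal; ring.
Qed.

Lemma qpow_INR (lq : C) (n : nat) : qpow lq (INR n) = Cexp lq ^ n.
Proof.
  induction n as [|n IH].
  - unfold qpow; cbn; replace (0 * lq) with (RtoC 0) by ring; apply Cexp_0.
  - rewrite S_INR, RtoC_plus, qpow_plus, IH; unfold qpow.
    replace (1 * lq) with lq by ring; cbn; ring.
Qed.

(** If q^c q^n = 1, multiplying by q^(-n) gives the excluded equality q^c = q^(-n). This turns the
    conditions on the parameters into nonvanishing denominators. *)
Lemma qpow_factor_neq_0 (lq c : C) :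
  (forall n : nat, qpow lq c <> qpow lq (- INR n)) ->
  forall n : nat, 1 - qpow lq c * Cexp lq ^ n <> 0.
Proof.
  intros Hc n H; apply (Hc n).
  assert (H1 : qpow lq (- INR n) * Cexp lq ^ n = 1).
  { rewrite <- qpow_INR, <- qpow_plus; unfold qpow.
    replace ((- INR n + INR n) * lq) with (RtoC 0) by ring; apply Cexp_0. }
  assert (H2 : qpow lq c * Cexp lq ^ n = 1)
    by (symmetry; apply Ceq_minus, H).
  transitivity (qpow lq c * (qpow lq (- INR n) * Cexp lq ^ n)).
  - rewrite H1; ring.
  - transitivity (qpow lq c * Cexp lq ^ n * qpow lq (- INR n)); [ring |].
    rewrite H2; ring.
Qed.

(** * The iterated q-difference of a double series *)

(** The operator at q^n z reads values at q^n z and q^(n+1) z only, so the formula is proved at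
    every point of the orbit, where the powers and [F] are known. The induction on r keeps a and n
    general: its step uses the formula at n and n+1, with a+1 in place of a. *)
Lemma iter_qdiff_orbit (q lq z : C) (pw : C -> C -> C) (F : C -> C)
  (w : nat -> nat -> C) (deg : nat -> nat -> nat) :
  (0 < Cmod q < 1)%R -> Cexp lq = q -> z <> 0 -> compatible_power q lq z pw ->
  geom_dominated w ->
  (forall n, F (q ^ n * z) = double_series (fun l k => w l k * (q ^ n) ^ deg l k)) ->
  forall (r : nat) (a : C) (n : nat),
    Nat.iter r (qdiff q) (fun t => pw t (a + INR r - 1) * F t) (q ^ n * z)
    = / (1 - q) ^ r * pw (q ^ n * z) (a - 1)
      * double_series (fun l k =>
          w l k * ((q ^ n) ^ deg l k * qpoch (qpow lq a * q ^ deg l k) q r)).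
Proof.
  intros Hq Hlq Hz Hpw Hw HF.
  assert (Hq1 : 1 - q <> 0) by (apply one_minus_neq_0; lra).
  assert (Hq0 : q <> 0) by (apply Cmod_gt_0; lra).
  induction r as [|r IH]; intros a n.
  - cbn [Nat.iter nat_rect]; rewrite HF.
    replace (a + INR 0 - 1) with (a - 1) by (cbn; ring).
    replace (fun l k => w l k * ((q ^ n) ^ deg l k * qpoch (qpow lq a * q ^ deg l k) q 0))
      with (fun l k => w l k * (q ^ n) ^ deg l k)
      by (do 2 (apply functional_extensionality; intro); cbn; ring).
    cbn; field; apply C1_nz.
  - rewrite Nat.iter_succ.
    replace (a + INR (S r) - 1) with ((a + 1) + INR r - 1)
      by (rewrite S_INR, RtoC_plus; ring).
    unfold qdiff at 1.
    replace (q * (q ^ n * z)) with (q ^ S n * z) by (cbn; ring).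
    rewrite !IH.
    replace (a + 1 - 1) with a by ring.
    (* At t = q^n z: (q t)^a = q^a t^a and t^a = t t^(a-1). The factor t cancels the one in the
       denominator of the operator. *)
    destruct (Hpw n a) as (_ & Hshift & _).
    destruct (Hpw n (a - 1)) as (_ & _ & Hsucc).
    replace (a - 1 + 1) with a in Hsucc by ring.
    replace (q ^ S n * z) with (q * (q ^ n * z)) by (cbn; ring).
    rewrite Hshift, Hsucc.
    set (G := fun m l k => w l k *
       ((q ^ m) ^ deg l k * qpoch (qpow lq (a + 1) * q ^ deg l k) q r)).
    (* Convergence is what allows the two series to be subtracted termwise: |(q^m)^deg| <= 1, and
       the shifted factorial of fixed length r is bounded uniformly in deg. *)
    assert (HG : forall m, ex_double_series (G m)).
    { intros m; apply geom_dominated_ex_double_series.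
      apply geom_dominated_mult
        with (B := (1 * (1 + Cmod (qpow lq (a + 1))) ^ r)%R); [exact Hw |].
      intros l k; rewrite Cmod_mult; apply Rmult_le_compat; try apply Cmod_ge_0.
      - rewrite <- Cpow_mult_r; apply Cmod_pow_le_1; lra.
      - apply Cmod_qpoch_le; [lra |]; rewrite Cmod_mult.
        generalize (Cmod_pow_le_1 q (deg l k)) (Cmod_ge_0 (qpow lq (a + 1))); nra. }
    (* (q^(a+deg);q)_(r+1) = (1 - q^(a+deg)) (q^(a+1+deg);q)_r, and q^deg (q^n)^deg = (q^(n+1))^deg
       turns the second product into q^a times the term of [G (S n)]. *)
    replace (fun l k => w l k * ((q ^ n) ^ deg l k
                          * qpoch (qpow lq a * q ^ deg l k) q (S r)))
      with (fun l k => G n l k - qpow lq a * G (S n) l k).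
    2:{ apply functional_extensionality; intro l; apply functional_extensionality; intro k.
        unfold G; rewrite qpoch_S_l, qpow_plus.
        replace (qpow lq 1) with q
          by (unfold qpow; rewrite Cmult_1_l; symmetry; exact Hlq).
        replace (qpow lq a * q * q ^ deg l k) with (qpow lq a * q ^ deg l k * q) by ring.
        rewrite Cpow_S, Cpow_mult_l; ring. }
    rewrite (double_series_unique _ _ (is_double_series_minus _ _ _ _
      (double_series_correct _ (HG n))
      (is_double_series_scal (qpow lq a) _ _ (double_series_correct _ (HG (S n)))))).
    fold (G n) (G (S n)).
    cbn [Cpow]; field; repeat split; auto using Cpow_nz.
Qed.

(** The case n = 0 for terms (q^a;q)_deg v, where [v] holds everything except the shifted factorial
    whose parameter is raised. *)
Lemma iter_qdiff_double_series (q lq z a : C) (r : nat) (pw : C -> C -> C) (F : C -> C)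
  (v : nat -> nat -> C) (deg : nat -> nat -> nat) :
  (0 < Cmod q < 1)%R -> Cexp lq = q -> z <> 0 -> compatible_power q lq z pw ->
  geom_dominated v ->
  (forall n, F (q ^ n * z) = double_series (fun l k =>
     qpoch (qpow lq a) q (deg l k) * v l k * (q ^ n) ^ deg l k)) ->
  Nat.iter r (qdiff q) (fun t => pw t (a + INR r - 1) * F t) z
  = qpoch (qpow lq a) q r / (1 - q) ^ r * pw z (a - 1)
    * double_series (fun l k => qpoch (qpow lq (a + INR r)) q (deg l k) * v l k).
Proof.
  intros Hq Hlq Hz Hpw Hv HF.
  assert (Hdom : forall A, geom_dominated (fun l k => qpoch A q (deg l k) * v l k)).
  { intros A; destruct (qpoch_bounded A q) as [B HB]; [lra |].
    replace (fun l k => qpoch A q (deg l k) * v l k)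
      with (fun l k => v l k * qpoch A q (deg l k))
      by (do 2 (apply functional_extensionality; intro); ring).
    apply geom_dominated_mult with B; auto. }
  generalize (iter_qdiff_orbit q lq z pw F _ deg Hq Hlq Hz Hpw
    (Hdom (qpow lq a)) HF r a 0).
  replace (q ^ 0 * z) with z by (cbn; ring).
  intros ->.
  replace (fun l k => qpoch (qpow lq a) q (deg l k) * v l k *
      ((q ^ 0) ^ deg l k * qpoch (qpow lq a * q ^ deg l k) q r))
    with (fun l k => qpoch (qpow lq a) q r
            * (qpoch (qpow lq (a + INR r)) q (deg l k) * v l k)).
  - rewrite (double_series_unique _ _ (is_double_series_scal _ _ _
      (double_series_correct _ (geom_dominated_ex_double_series _ (Hdom _))))).
    unfold Cdiv; ring.
  - apply functional_extensionality; intro l; apply functional_extensionality; intro k.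
    cbn [Cpow]; rewrite Cpow_1_l, qpow_plus, qpow_INR, Hlq.
    (* Both sides contain (q^a;q)_(deg+r), split after r factors on one side and after deg factors
       on the other. *)
    transitivity (v l k * (qpoch (qpow lq a) q r * qpoch (qpow lq a * q ^ r) q (deg l k)));
      [ring |].
    rewrite <- qpoch_add, Nat.add_comm, qpoch_add; ring.
Qed.

(** * Application to the bibasic Humbert functions *)

(** The four inverse shifted factorials are bounded, and the powers of X and Y supply the geometric
    decay. [num] is left open for the numerator that remains once the raised factor is taken out. *)
Lemma humbert_terms_dominated (q p lq lp c d X Y : C) (num : nat -> nat -> C) (B : R) :
  (Cmod q < 1)%R -> (Cmod p < 1)%R -> Cexp lq = q -> Cexp lp = p ->
  (forall n : nat, qpow lp c <> qpow lp (- INR n)) ->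
  (forall n : nat, qpow lq d <> qpow lq (- INR n)) ->
  (Cmod X < 1)%R -> (Cmod Y < 1)%R -> (forall l k, Cmod (num l k) <= B)%R ->
  geom_dominated (fun l k => num l k
    / (qpoch (qpow lp c) p l * qpoch (qpow lq d) q k * qpoch q q k * qpoch p p l)
    * X ^ k * Y ^ l).
Proof.
  intros Hq Hp Hlq Hlp Hc Hd HX HY Hnum.
  (* The factors of (t;t)_k do not vanish because |t^(n+1)| < 1; used for t = q and t = p. *)
  assert (Hself : forall t, (Cmod t < 1)%R -> forall n, 1 - t * t ^ n <> 0).
  { intros t Ht n; apply one_minus_neq_0; rewrite Cmod_mult.
    generalize (Cmod_pow_le_1 t n Ht) (Cmod_ge_0 t); nra. }
  assert (Hc' := qpow_factor_neq_0 lp c Hc); rewrite Hlp in Hc'.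
  assert (Hd' := qpow_factor_neq_0 lq d Hd); rewrite Hlq in Hd'.
  destruct (inv_qpoch_bounded _ p Hp Hc') as [B1 H1].
  destruct (inv_qpoch_bounded _ q Hq Hd') as [B2 H2].
  destruct (inv_qpoch_bounded q q Hq (Hself q Hq)) as [B3 H3].
  destruct (inv_qpoch_bounded p p Hp (Hself p Hp)) as [B4 H4].
  assert (Hnz : forall A t n, (forall n, 1 - A * t ^ n <> 0) -> qpoch A t n <> 0).
  { intros A t n HA; induction n; cbn; [apply C1_nz | apply Cmult_neq_0; auto]. }
  apply geom_dominated_powers with (B := (B * (B1 * B2 * B3 * B4))%R); [exact HX | exact HY |].
  intros l k.
  replace (num l k / (qpoch (qpow lp c) p l * qpoch (qpow lq d) q k
                      * qpoch q q k * qpoch p p l))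
    with (num l k * (/ qpoch (qpow lp c) p l * / qpoch (qpow lq d) q k
                     * / qpoch q q k * / qpoch p p l))
    by (field; repeat split; apply Hnz; auto).
  rewrite !Cmod_mult.
  repeat (apply Rmult_le_compat; auto using Cmod_ge_0, Rmult_le_pos).
Qed.

Ltac double_series_ext :=
  f_equal; apply functional_extensionality; intro l;
  apply functional_extensionality; intro k;
  rewrite ?Cpow_mult_l, ?Cpow_add_r; unfold Cdiv; ring.

Theorem theorem2p8 (q p lq lp : C)
  (hq : (0 < Cmod q < 1)%R) (hp : (0 < Cmod p < 1)%R)
  (hlq : Cexp lq = q) (hlp : Cexp lp = p)
  (r : nat) (hr : (0 < r)%nat)
  (x y : C) (hx : x <> 0) (hy : y <> 0) :
  (forall a b c d : C,
    (forall n : nat, qpow lp c <> qpow lp (- INR n)) ->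
    (forall n : nat, qpow lq d <> qpow lq (- INR n)) ->
    ((Cmod x < 1)%R -> (Cmod y < 1)%R ->
     forall pw : C -> C -> C, compatible_power p lp y pw ->
     Nat.iter r (qdiff p)
       (fun t => pw t (b + INR r - 1)
          * Psi1 (qpow lq a) (qpow lp b) (qpow lp c) (qpow lq d) q p x t) y
     = qpoch (qpow lp b) p r / (1 - p) ^ r * pw y (b - 1)
       * Psi1 (qpow lq a) (qpow lp (b + INR r)) (qpow lp c) (qpow lq d) q p x y)
    /\
    ((Cmod x < 1)%R -> (Cmod (x * y) < 1)%R ->
     forall pw : C -> C -> C, compatible_power q lq x pw ->
     Nat.iter r (qdiff q)
       (fun t => pw t (a + INR r - 1)
          * Psi1 (qpow lq a) (qpow lp b) (qpow lp c) (qpow lq d) q p t (t * y)) x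
     = qpoch (qpow lq a) q r / (1 - q) ^ r * pw x (a - 1)
       * Psi1 (qpow lq (a + INR r)) (qpow lp b) (qpow lp c) (qpow lq d) q p x (x * y))
    /\
    ((Cmod (x * y) < 1)%R -> (Cmod y < 1)%R ->
     forall pw : C -> C -> C, compatible_power q lq y pw ->
     Nat.iter r (qdiff q)
       (fun t => pw t (a + INR r - 1)
          * Psi1 (qpow lq a) (qpow lp b) (qpow lp c) (qpow lq d) q p (x * t) t) y
     = qpoch (qpow lq a) q r / (1 - q) ^ r * pw y (a - 1)
       * Psi1 (qpow lq (a + INR r)) (qpow lp b) (qpow lp c) (qpow lq d) q p (x * y) y))
  /\
  (forall a b c : C,
    (forall n : nat, qpow lp b <> qpow lp (- INR n)) ->
    (forall n : nat, qpow lq c <> qpow lq (- INR n)) ->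
    ((Cmod x < 1)%R -> (Cmod (x * y) < 1)%R ->
     forall pw : C -> C -> C, compatible_power q lq x pw ->
     Nat.iter r (qdiff q)
       (fun t => pw t (a + INR r - 1)
          * Psi2 (qpow lq a) (qpow lp b) (qpow lq c) q p t (t * y)) x
     = qpoch (qpow lq a) q r / (1 - q) ^ r * pw x (a - 1)
       * Psi2 (qpow lq (a + INR r)) (qpow lp b) (qpow lq c) q p x (x * y))
    /\
    ((Cmod (x * y) < 1)%R -> (Cmod y < 1)%R ->
     forall pw : C -> C -> C, compatible_power q lq y pw ->
     Nat.iter r (qdiff q)
       (fun t => pw t (a + INR r - 1)
          * Psi2 (qpow lq a) (qpow lp b) (qpow lq c) q p (x * t) t) y
     = qpoch (qpow lq a) q r / (1 - q) ^ r * pw y (a - 1)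
       * Psi2 (qpow lq (a + INR r)) (qpow lp b) (qpow lq c) q p (x * y) y)).

Proof.
  destruct hq as [hq0 hq1], hp as [hp0 hp1].
  assert (Hterm : forall c d X Y num B,
    (forall n : nat, qpow lp c <> qpow lp (- INR n)) ->
    (forall n : nat, qpow lq d <> qpow lq (- INR n)) ->
    (Cmod X < 1)%R -> (Cmod Y < 1)%R -> (forall l k : nat, Cmod (num l k) <= B)%R ->
    geom_dominated (fun l k => num l k
      / (qpoch (qpow lp c) p l * qpoch (qpow lq d) q k * qpoch q q k * qpoch p p l)
      * X ^ k * Y ^ l))
    by (intros; eapply humbert_terms_dominated; eauto).
  split.
  - intros a b c d Hc Hd.
    destruct (qpoch_bounded (qpow lq a) q hq1) as [Ba HBa].
    destruct (qpoch_bounded (qpow lp b) p hp1) as [Bb HBb].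
    split; [| split]; intros HX HY pw Hpw.
    + etransitivity.
      (* In base p only y^l varies, so deg = l and (p^b;p)_l is the raised factor; (q^a;q)_(k+l)
         stays in the bounded numerator. *)
      * apply (iter_qdiff_double_series p lp y b r pw
          (fun t => Psi1 (qpow lq a) (qpow lp b) (qpow lp c) (qpow lq d) q p x t)
          _ (fun l _ => l) (conj hp0 hp1) hlp hy Hpw
          (Hterm _ _ x y (fun l k => qpoch (qpow lq a) q (k + l)) Ba Hc Hd HX HY
             (fun l k => HBa (k + l)%nat))).
        intros n; unfold Psi1; double_series_ext.
      * unfold Psi1; f_equal; double_series_ext.
    + etransitivity.
      (* Here x enters both arguments, so deg = k+l, which is the index of the raised factor
         (q^a;q)_(k+l); (p^b;p)_l remains. *)
      * apply (iter_qdiff_double_series q lq x a r pw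
          (fun t => Psi1 (qpow lq a) (qpow lp b) (qpow lp c) (qpow lq d) q p t (t * y))
          _ (fun l k => (k + l)%nat) (conj hq0 hq1) hlq hx Hpw
          (Hterm _ _ x (x * y) (fun l _ => qpoch (qpow lp b) p l) Bb Hc Hd HX HY
             (fun l _ => HBb l))).
        intros n; unfold Psi1; double_series_ext.
      * unfold Psi1; f_equal; double_series_ext.
    + etransitivity.
      * apply (iter_qdiff_double_series q lq y a r pw
          (fun t => Psi1 (qpow lq a) (qpow lp b) (qpow lp c) (qpow lq d) q p (x * t) t)
          _ (fun l k => (k + l)%nat) (conj hq0 hq1) hlq hy Hpw
          (Hterm _ _ (x * y) y (fun l _ => qpoch (qpow lp b) p l) Bb Hc Hd HX HY
             (fun l _ => HBb l))).
        intros n; unfold Psi1; double_series_ext.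
      * unfold Psi1; f_equal; double_series_ext.
  - intros a b c Hc Hd.
    split; intros HX HY pw Hpw.
    + etransitivity.
      (* For [Psi2] the raised factor is the whole numerator, so the constant 1 remains. *)
      * apply (iter_qdiff_double_series q lq x a r pw
          (fun t => Psi2 (qpow lq a) (qpow lp b) (qpow lq c) q p t (t * y))
          _ (fun l k => (k + l)%nat) (conj hq0 hq1) hlq hx Hpw
          (Hterm _ _ x (x * y) (fun _ _ => RtoC 1) 1%R Hc Hd HX HY
             (fun _ _ => Req_le _ _ Cmod_1))).
        intros n; unfold Psi2; double_series_ext.
      * unfold Psi2; f_equal; double_series_ext.
    + etransitivity.
      * apply (iter_qdiff_double_series q lq y a r pw
          (fun t => Psi2 (qpow lq a) (qpow lp b) (qpow lq c) q p (x * t) t)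
          _ (fun l k => (k + l)%nat) (conj hq0 hq1) hlq hy Hpw
          (Hterm _ _ (x * y) y (fun _ _ => RtoC 1) 1%R Hc Hd HX HY
             (fun _ _ => Req_le _ _ Cmod_1))).
        intros n; unfold Psi2; double_series_ext.
      * unfold Psi2; f_equal; double_series_ext.
Qed.
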